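(* Let $m\ge1$ be an integer and $N>0$ a real number. The Young conjugation map $\mathcal Y:\mathcal P_m(N)\to\mathcal P_m(N)$ maps $$\tilde\triangle_0\cap\tilde\nabla_0\xrightarrow{\mathcal Y}\tilde\triangle_0\cap\tilde\nabla_0,\qquad \tilde\triangle_0\cap\tilde\nabla_1\xrightarrow{\mathcal Y}\tilde\triangle_1\cap\tilde\nabla_0,$$ $$\tilde\triangle_1\cap\tilde\nabla_0\xrightarrow{\mathcal Y}\tilde\triangle_0\cap\tilde\nabla_1,\qquad \tilde\triangle_1\cap\tilde\nabla_1\xrightarrow{\mathcal Y}\tilde\triangle_1\cap\tilde\nabla_1,\qquad \tilde\triangle_D\xrightarrow{\mathcal Y}\tilde\nabla_D.$$
   Context: Let $\mathcal P_m(N)=\{(\lambda_0,\dots,\lambda_m)\times[k_0,\dots,k_m]\in\mathbb R^{m+1}\times\mathbb R^{m+1}:\lambda_0>\cdots>\lambda_m>0,\ k_i>0,\ \sum_{i=0}^m\lambda_ik_i=N\}$. Subsets of $\mathcal P_m(N)$: $\tilde\triangle_0$, $\tilde\triangle_1$, $\tilde\triangle_D$ are the sets where $\lambda_0<\lambda_1+\lambda_m$, $\lambda_0>\lambda_1+\lambda_m$, $\lambda_0=\lambda_1+\lambda_m$, respectively; $\tilde\nabla_0,\tilde\nabla_1,\tilde\nabla_D$ are the sets where $k_0>k_m$, $k_0<k_m$, $k_0=k_m$, respectively. Young conjugation is $$\mathcal Y\big((\lambda_0,\dots,\lambda_m)\times[k_0,\dots,k_m]\big)=\Big(\sum_{i=0}^mk_i,\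 \sum_{i=0}^{m-1}k_i,\ \dots,\ k_0\Big)\times[\lambda_m,\lambda_{m-1}-\lambda_m,\lambda_{m-2}-\lambda_{m-1},\dots,\lambda_0-\lambda_1].$$ *)

(* Defs.v *)
From mathcomp Require Import all_boot all_order all_algebra.
From mathcomp Require Import mathcomp_extra boolp classical_sets functions reals.

Set Implicit Arguments.
Unset Strict Implicit.
Unset Printing Implicit Defensive.

Import Order.TTheory GRing.Theory Num.Theory.
Local Open Scope ring_scope.
Local Open Scope classical_set_scope.

Section RealPartitions.
Variables (R : realType) (m : nat).

(* [(l, k)] stands for (l_0, ..., l_m) x [k_0, ..., k_m]. *)
Definition coords : Type := ('rV[R]_m.+1 * 'rV[R]_m.+1)%type.

Definition real_partitions (N : R) : set coords :=
  [set x : coords | [/\ forall i j : 'I_m.+1, (i < j)%N -> x.1 0 j < x.1 0 i,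
               0 < x.1 0 ord_max,
               forall i, 0 < x.2 0 i
             & \sum_i x.1 0 i * x.2 0 i = N]].

(* The index 1 is written [inord 1], which has value 1 only for m >= 1. *)
Definition triangle0 (N : R) : set coords :=
  [set x : coords | real_partitions N x /\
           x.1 0 ord0 < x.1 0 (inord 1) + x.1 0 ord_max].

Definition triangle1 (N : R) : set coords :=
  [set x : coords | real_partitions N x /\
           x.1 0 ord0 > x.1 0 (inord 1) + x.1 0 ord_max].

Definition triangleD (N : R) : set coords :=
  [set x : coords | real_partitions N x /\
           x.1 0 ord0 = x.1 0 (inord 1) + x.1 0 ord_max].

Definition nabla0 (N : R) : set coords :=
  [set x : coords | real_partitions N x /\ x.2 0 ord0 > x.2 0 ord_max].

Definition nabla1 (N : R) : set coords :=
  [set x : coords | real_partitions N x /\ x.2 0 ord0 < x.2 0 ord_max].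

Definition nablaD (N : R) : set coords :=
  [set x : coords | real_partitions N x /\ x.2 0 ord0 = x.2 0 ord_max].

(* The j-th part is k_0 + ... + k_(m-j); the j-th multiplicity is l_m for
   j = 0 and l_(m-j) - l_(m-j+1) for j >= 1.  Here [rev_ord j] is m - j. *)
Definition young (x : coords) : coords :=
  (\row_j \sum_(i < m.+1 | (i <= m - j)%N) x.2 0 i,
   \row_j (if j == ord0 then x.1 0 ord_max
           else x.1 0 (rev_ord j) - x.1 0 (inord (m - j).+1%N))).

End RealPartitions.

Arguments real_partitions {R} m N.
Arguments triangle0 {R} m N.
Arguments triangle1 {R} m N.
Arguments triangleD {R} m N.
Arguments nabla0 {R} m N.
Arguments nabla1 {R} m N.
Arguments nablaD {R} m N.

(* Main.v *)
Require Import Defs.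
From mathcomp Require Import all_boot all_order all_algebra.
From mathcomp Require Import mathcomp_extra boolp classical_sets functions reals.
From mathcomp Require Import lra.
Import Order.TTheory GRing.Theory Num.Theory.
Local Open Scope ring_scope.
Local Open Scope classical_set_scope.

(** Write [(l', k')] for the conjugate of [(l, k)], and put [l_(m+1) = 0].
    With [K_i = k_0 + ... + k_i] one has [l'_(m-i) = K_i] and
    [k'_(m-i) = l_i - l_(i+1)].  So positivity of [k] makes [l'] decreasing,
    monotonicity of [l] makes [k'] positive, and summation by parts
    ([sum_by_parts]) turns the area [\sum_i K_i * (l_i - l_(i+1))] of the
    conjugate diagram into [\sum_i l_i * k_i], whence [young] preserves the
    space of real partitions ([young_real_partitions]).

    For the other five inclusions it suffices to look at the two numbers that
    separate the regions: [young_triangle_gap] says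
    [l'_0 - (l'_1 + l'_m) = k_m - k_0], and [young_nabla_gap] says
    [k'_m - k'_0 = l_0 - (l_1 + l_m)].  Conjugation thus exchanges the
    triangle gap with the nabla gap, and all inclusions are read off from the
    signs. *)

Section YoungConjugation.
Variables (R : realType) (m : nat).
Implicit Types (v : 'rV[R]_m.+1) (x : coords R m) (N : R).

(** The value 0 past [m] plays the part of [l_(m+1)], so that every
    multiplicity of the conjugate, [l_m] included, is a difference of
    consecutive values. *)
Definition extend v (i : nat) : R := if (i <= m)%N then v 0 (inord i) else 0.

Definition partial_sum v (n : nat) : R := \sum_(i < m.+1 | (i <= n)%N) v 0 i.

Lemma inord_max : inord m = ord_max :> 'I_m.+1.
Proof. by apply: val_inj; rewrite /= inordK. Qed.

Lemma extend_ord v (i : 'I_m.+1) : extend v i = v 0 i.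
Proof. by rewrite /extend -ltnS ltn_ord inord_val. Qed.

Lemma partial_sum0 v : partial_sum v 0 = v 0 ord0.
Proof. by apply: big_pred1 => i; rewrite leqn0. Qed.

Lemma partial_sumS v n : (n < m)%N ->
  partial_sum v n.+1 = partial_sum v n + v 0 (inord n.+1).
Proof.
move=> ltnm; rewrite /partial_sum (bigD1 (inord n.+1)) /=; last first.
  by rewrite inordK.
rewrite addrC; congr (_ + _); apply: eq_bigl => i.
by rewrite -val_eqE /= inordK // -(ltnS i n) ltn_neqAle andbC.
Qed.

Lemma partial_sum_lt v a b : (forall i, 0 < v 0 i) ->
  (a < b <= m)%N -> partial_sum v a < partial_sum v b.
Proof.
move=> v_gt0; elim: b => // b IHb /andP[]; rewrite ltnS => leab ltbm.
rewrite partial_sumS //; have pos := v_gt0 (inord b.+1).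
move: leab; rewrite leq_eqVlt => /predU1P[->|ltab]; first lra.
have := IHb; rewrite ltab ltnW // => /(_ isT); lra.
Qed.

(** Summation by parts: exchanging the sums, each [k_t] gets the telescoping
    coefficient [\sum_(t <= i <= m) (l_i - l_(i+1)) = l_t - l_(m+1) = l_t]. *)
Lemma sum_by_parts (l k : 'rV[R]_m.+1) :
  \sum_(i < m.+1) partial_sum k i * (extend l i - extend l i.+1) =
  \sum_(i < m.+1) l 0 i * k 0 i.
Proof.
under eq_bigr do rewrite mulr_suml.
rewrite (exchange_big_dep predT) //=; apply: eq_bigr => t _.
rewrite -mulr_sumr mulrC; congr (_ * _).
rewrite -(big_geq_mkord t m.+1 predT (fun i => extend l i - extend l i.+1)).
rewrite (telescope_sumr_eq (fun i => - extend l i)); last 2 first.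
- exact: ltnW.
- by move=> i _; rewrite opprK addrC.
by rewrite opprK extend_ord /extend ltnn oppr0 add0r.
Qed.

Lemma young_partE x j : (young x).1 0 j = partial_sum x.2 (m - j).
Proof. by rewrite mxE. Qed.

Lemma young_multE x (j : 'I_m.+1) :
  (young x).2 0 j = extend x.1 (m - j) - extend x.1 (m - j).+1.
Proof.
rewrite mxE -{2}(subSS j m) -/(rev_ord j) (extend_ord _ (rev_ord j)).
rewrite /extend; case: eqP => [->|/eqP].
  rewrite subn0 ltnn subr0; congr (x.1 _ _).
  by apply: val_inj; rewrite /= subn1.
rewrite -val_eqE /= -lt0n => j_gt0.
by rewrite ltn_subrL j_gt0 (leq_trans j_gt0) // -ltnS.
Qed.

Lemma young_real_partitions N :
  set_fun (real_partitions m N) (real_partitions m N) (@young R m).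
Proof.
move=> x [l_decr l_gt0 k_gt0 sumN]; split.
- move=> i j ltij; rewrite !young_partE; apply: partial_sum_lt => //.
  by rewrite leq_subr andbT ltn_sub2l // (leq_trans ltij) // -ltnS.
- by rewrite young_partE subnn partial_sum0.
- move=> j; rewrite young_multE subr_gt0 /extend leq_subr.
  case: ifP => [ltm|gem]; last first.
    (* here [j = 0], and the multiplicity is [l_m - l_(m+1) = l_m] *)
    have -> : (m - j)%N = m by apply/eqP; rewrite eqn_leq leq_subr leqNgt gem.
    by rewrite inord_max.
  by apply: l_decr; rewrite !inordK // ltnS leq_subr.
rewrite -sumN -(sum_by_parts x.1 x.2) (reindex_inj rev_ord_inj).
apply: eq_bigr => i _; rewrite young_partE young_multE /= subSS subKn //.
by rewrite -ltnS.
Qed.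

Lemma young_triangle_gap x : (1 <= m)%N ->
  (young x).1 0 ord0 - ((young x).1 0 (inord 1) + (young x).1 0 ord_max) =
  x.2 0 ord_max - x.2 0 ord0.
Proof.
move=> m_gt0; rewrite !young_partE subnn partial_sum0 subn0 inordK // subn1.
have := @partial_sumS x.2 m.-1; rewrite prednK // => /(_ (leqnn m)) ->.
rewrite inord_max; lra.
Qed.

Lemma young_nabla_gap x : (1 <= m)%N ->
  (young x).2 0 ord_max - (young x).2 0 ord0 =
  x.1 0 ord0 - (x.1 0 (inord 1) + x.1 0 ord_max).
Proof.
move=> m_gt0; rewrite !young_multE subnn subn0.
rewrite (extend_ord _ ord0) (extend_ord _ ord_max) /extend m_gt0 ltnn; lra.
Qed.

End YoungConjugation.

Theorem proposition8p6 (R : realType) (m : nat) (N : R)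
    (hm : (1 <= m)%N) (hN : 0 < N) :
  set_fun (real_partitions m N) (real_partitions m N) (@young R m) /\
  set_fun (triangle0 m N `&` nabla0 m N) (triangle0 m N `&` nabla0 m N)
    (@young R m) /\
  set_fun (triangle0 m N `&` nabla1 m N) (triangle1 m N `&` nabla0 m N)
    (@young R m) /\
  set_fun (triangle1 m N `&` nabla0 m N) (triangle0 m N `&` nabla1 m N)
    (@young R m) /\
  set_fun (triangle1 m N `&` nabla1 m N) (triangle1 m N `&` nabla1 m N)
    (@young R m) /\
  set_fun (triangleD m N) (nablaD m N) (@young R m).
Proof.
have youngP := @young_real_partitions R m N.
have tri_gap x := @young_triangle_gap R m x hm.
have nab_gap x := @young_nabla_gap R m x hm.
split; first exact: youngP.
do 4! [split; first by move=> x [[Px tri] [_ nab]];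
  have := tri_gap x; have := nab_gap x;
  split; (split; [exact: youngP | lra])].
move=> x [Px tri]; have := nab_gap x.
by split; [exact: youngP | lra].
Qed.
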